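(* Let $\ell$ and $n$ be nonnegative integers and let $a,b,c$ be complex numbers such that no lower parameter of the series below is a nonpositive integer and all denominators below are nonzero. Then $$\frac{c+a+bn}{c+a}\,\frac{(c+a)_n}{(c)_n}=\frac{(-n)_\ell(-a)_\ell}{\ell!\,(1-c-n)}\;\frac{(b-1)\ell-c-bn+1}{\prod_{1\le j\le\ell}(\ell-j+c)}$$ $$\times\;{}_{2\ell+3}F_{2\ell+2}\left[\begin{matrix}a+1,\ 1+\frac{c+bn-(b-1)\ell-1}{\ell-b(\ell+1)},\ \left\{\frac{\ell+j-n}{\ell+1}\right\}_{j=0}^{\ell},\ \left\{\frac{\ell+j-a-1}{\ell}\right\}_{j=1}^{\ell}\\ 2-c-n,\ \frac{c+bn-(b-1)\ell-1}{\ell-b(\ell+1)},\ \left\{\frac{\ell+j+1}{\ell+1}\right\}_{j=1}^{\ell},\ \left\{\frac{2\ell-j+c}{\ell}\right\}_{j=1}^{\ell}\end{matrix};1\right]$$ $$+\sum_{i=1}^{\ell}\frac{(-n)_{i-1}}{(i-1)!}\;\frac{(-a)_{i-1}\bigl(c+bn-(b-1)(i-1)\bigr)}{\prod_{1\le j\le\ell}\ \prod_{1\le k\le\left[\frac{i+j}{\ell+1}\right]}(k\ell-j+c)}$$ $$\times\;{}_{2\ell+4}F_{2\ell+3}\left[\begin{matrix}1,\ a+1,\ 1+\frac{c+bn-(b-1)(i-1)}{\ell-b(\ell+1)},\ \left\{\frac{i+j-n-1}{\ell+1}\right\}_{j=0}^{\ell},\ \left\{\frac{i+j-a-2}{\ell}\right\}_{j=1}^{\ell}\\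 1-c-n,\ \frac{c+bn-(b-1)(i-1)}{\ell-b(\ell+1)},\ \left\{\frac{i+j}{\ell+1}\right\}_{j=0}^{\ell},\ \left\{\frac{\ell-j+c}{\ell}+\left[\frac{i+j}{\ell+1}\right]\right\}_{j=1}^{\ell}\end{matrix};1\right].$$
   Context: $[x]$ denotes the integer part of the real number $x$. $(x)_0=1$ and $(x)_n=x(x+1)\cdots(x+n-1)$ for $n\ge1$. The generalized hypergeometric series is ${}_pF_q\left[\begin{matrix}a_1,\dots,a_p\\ b_1,\dots,b_q\end{matrix};z\right]=\sum_{k\ge0}\frac{(a_1)_k\cdots(a_p)_k}{(b_1)_k\cdots(b_q)_k}\frac{z^k}{k!}$, with lower parameters $b_j\in\mathbb{C}\setminus\mathbb{Z}_{\le0}$. A symbol $\{x_j\}_{j=r}^{s}$ inside a parameter list stands for the parameters $x_r,x_{r+1},\dots,x_s$ (none if $s<r$); empty products equal $1$ and empty sums equal $0$. Series whose coefficient is nonzero terminate; a term whose coefficient vanishes because $(-n)_\ell=0$ (when $n<\ell$) or $(-n)_{i-1}=0$ (when $n<i-1$) is read as $0$. *)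

(* Defs.v *)
From HB Require Import structures.
From mathcomp Require Import all_boot all_order all_algebra.
From mathcomp Require Import complex.
From mathcomp Require Import boolp classical_sets reals topology normedtype.
From mathcomp Require Import sequences.

Set Implicit Arguments.
Unset Strict Implicit.
Unset Printing Implicit Defensive.

Import Order.TTheory GRing.Theory Num.Theory.
Import numFieldNormedType.Exports.

Local Open Scope classical_set_scope.
Local Open Scope ring_scope.

Definition poch (K : numFieldType) (x : K) (n : nat) : K :=
  \prod_(i < n) (x + i%:R).

Definition hyp_term (K : numFieldType) (us ls : seq K) (z : K) (k : nat) : K :=
  (\prod_(u <- us) poch u k) / (\prod_(v <- ls) poch v k) * (z ^+ k / k`!%:R).

(* Stated over an arbitrary numFieldType so that the limit uses the topology
   that MathComp-Analysis derives from the norm; the theorem takes K := R[i].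
   limn is total, so the value is meaningful only when the series converges;
   hypF_terminating covers the terminating case. *)
Definition hypF (K : numFieldType) (us ls : seq K) (z : K) : K :=
  limn (series (hyp_term us ls z)).

Lemma hypF_terminating (K : numFieldType) (us ls : seq K) (z : K) (m : nat) :
  - m%:R \in us -> hypF us ls z = \sum_(k < m.+1) hyp_term us ls z k.
Proof.
move=> um; apply: cvg_lim; first exact: norm_hausdorff.
apply: cvg_near_cst; near=> N.
have le_mN : (m.+1 <= N)%N by near: N; exact: nbhs_infty_ge.
rewrite /series /= (big_cat_nat _ le_mN) //= big_mkord.
rewrite [X in _ + X]big1_seq ?addr0 // => k /andP[_].
rewrite mem_index_iota => /andP[lt_mk _].
rewrite /hyp_term (big_rem _ um) /= /poch (bigD1 (Ordinal lt_mk)) //=.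
by rewrite addNr !mul0r.
Unshelve. all: by end_near. Qed.

Definition nonpos_integer (K : numFieldType) (x : K) : Prop :=
  exists m : nat, x = - m%:R.

Definition lower_params_ok (K : numFieldType) (ls : seq K) : Prop :=
  forall v, v \in ls -> ~ nonpos_integer v.

(* {x_j}_{j=r}^{s}, empty when s < r *)
Definition params (K : numFieldType) (r s : nat) (x : nat -> K) : seq K :=
  [seq x j | j <- index_iota r s.+1].

(* ratio0, upper0, lower0, denom0 belong to the first term of the identity, and
   ratio, upper, lower, denom to the i-th term of the sum over 1 <= i <= l.
   The integer part [(i+j)/(l+1)] is the quotient (i + j) %/ l.+1 in nat. *)

Definition ratio0 (K : numFieldType) (l n : nat) (b c : K) : K :=
  (c + b * n%:R - (b - 1) * l%:R - 1) / (l%:R - b * (l%:R + 1)).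

Definition upper0 (K : numFieldType) (l n : nat) (a b c : K) : seq K :=
  [:: a + 1; 1 + ratio0 l n b c]
  ++ params 0 l (fun j => (l%:R + j%:R - n%:R) / (l%:R + 1))
  ++ params 1 l (fun j => (l%:R + j%:R - a - 1) / l%:R).

Definition lower0 (K : numFieldType) (l n : nat) (b c : K) : seq K :=
  [:: 2 - c - n%:R; ratio0 l n b c]
  ++ params 1 l (fun j => (l%:R + j%:R + 1) / (l%:R + 1))
  ++ params 1 l (fun j => (2 * l%:R - j%:R + c) / l%:R).

Definition denom0 (K : numFieldType) (l : nat) (c : K) : K :=
  \prod_(1 <= j < l.+1) (l%:R - j%:R + c).

Definition ratio (K : numFieldType) (l n : nat) (b c : K) (i : nat) : K :=
  (c + b * n%:R - (b - 1) * (i%:R - 1)) / (l%:R - b * (l%:R + 1)).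

Definition upper (K : numFieldType) (l n : nat) (a b c : K) (i : nat) : seq K :=
  [:: 1; a + 1; 1 + ratio l n b c i]
  ++ params 0 l (fun j => (i%:R + j%:R - n%:R - 1) / (l%:R + 1))
  ++ params 1 l (fun j => (i%:R + j%:R - a - 2) / l%:R).

Definition lower (K : numFieldType) (l n : nat) (b c : K) (i : nat) : seq K :=
  [:: 1 - c - n%:R; ratio l n b c i]
  ++ params 0 l (fun j => (i%:R + j%:R) / (l%:R + 1))
  ++ params 1 l (fun j => (l%:R - j%:R + c) / l%:R + ((i + j) %/ l.+1)%:R).

Definition denom (K : numFieldType) (l : nat) (c : K) (i : nat) : K :=
  \prod_(1 <= j < l.+1) \prod_(1 <= k < ((i + j) %/ l.+1).+1)
    (k%:R * l%:R - j%:R + c).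

(* Main.v *)
Require Import Defs.
From HB Require Import structures.
From mathcomp Require Import all_boot all_order all_algebra.
From mathcomp Require Import complex.
From mathcomp Require Import boolp classical_sets reals topology normedtype.
From mathcomp Require Import sequences.
From mathcomp Require Import ring zify.

Import Order.TTheory GRing.Theory Num.Theory.
Import numFieldNormedType.Exports.

Local Open Scope ring_scope.
Local Open Scope complex_scope.

(** The right-hand side is one finite sum cut into residue classes.  Let
    k_m = [m/(l+1)].  By the multiplication theorem for Pochhammer symbols the
    parameter families spaced by 1/(l+1) and 1/l glue together, and the k-th
    term of the series belonging to the residue r (r = i - 1 < l for the i-th
    series of the sum, r = l for the isolated one) becomes the term of index
    m = r + k (l+1) of the single family [summand], divided by (c)_n:
<<
    binom(n,m) (a+k_m-m+1)_m
      * ((c+m-k_{m+1})_{n-m} + b (n-m) (c+m+1-k_{m+1})_{n-m-1}).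
>>
    In the notation of [summand], k = k_m and k' = k_{m+1}; they agree except
    on the residue r = l, which is why that class has a series of a slightly
    different shape.  This is [term_upper] and [term_upper0]; the linear factor
    c + b n - (b-1) r + k (l - b (l+1)) comes from the pair of parameters
    (1 + x, x), since (1+x)_k / (x)_k = (x+k)/x.

    The sum over m is then evaluated coefficient by coefficient in b.  The part
    free of b is the expansion [poch_expansion],
<<
    sum_m binom(n,m) (a+k_m-m+1)_m (c+m-k_{m+1})_{n-m} = (c+a)_n,
>>
    an Abel-type deformation of the Vandermonde convolution which holds for
    every sequence k of natural numbers whose increments are 0 or 1.  The part linear in b
    is the same expansion for n - 1 and c + 1, giving n (c+a+1)_{n-1}, that is,
    n (c+a)_n / (c+a); the two add up to (c+a+bn)/(c+a) (c+a)_n.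

    The expansion is proved by induction on n, both sides being polynomials in
    a: the difference operator a -> a+1 turns the identity for (n+1, c, k) into
    the one for (n, c+1, shifted k), and at a = - k_1 all terms with m > 0
    vanish, so the two sides agree at that point. *)

(** * Pochhammer symbols *)

Lemma poch0 (K : numFieldType) (x : K) : poch x 0 = 1.
Proof. by rewrite /poch big_ord0. Qed.

Lemma pochSr (K : numFieldType) (x : K) m : poch x m.+1 = poch x m * (x + m%:R).
Proof. by rewrite /poch big_ord_recr. Qed.

Lemma pochD (K : numFieldType) (x : K) m p :
  poch x (m + p) = poch x m * poch (x + m%:R) p.
Proof.
rewrite /poch big_split_ord /=; congr (_ * _).
by apply: eq_bigr => i _; rewrite natrD addrA.
Qed.

Lemma pochS (K : numFieldType) (x : K) m : poch x m.+1 = x * poch (x + 1) m.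
Proof. by rewrite -add1n pochD pochSr poch0 mul1r addr0. Qed.

Lemma poch1 (K : numFieldType) m : poch (1 : K) m = m`!%:R.
Proof.
elim: m => [|m IH]; first by rewrite poch0.
by rewrite pochSr IH factS natrM nat1r mulrC.
Qed.

(** Reversal of the factors; it turns falling factorials, which the argument
    produces, into Pochhammer symbols. *)
Lemma pochN (K : numFieldType) (x : K) m :
  poch (- x) m = (-1) ^+ m * poch (x - m%:R + 1) m.
Proof.
elim: m => [|m IH]; first by rewrite !poch0 mul1r.
rewrite pochSr IH pochS exprS.
rewrite (_ : x - m.+1%:R + 1 = x - m%:R); last by ring.
by ring.
Qed.

Lemma poch_eq0 (K : numFieldType) (x : K) m :
  (poch x m == 0) = [exists i : 'I_m, x + i%:R == 0].
Proof.
rewrite /poch; apply/prodf_eq0/existsP => [[i _ h]|[i h]]; by exists i.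
Qed.

Lemma poch_neq0 (K : numFieldType) (x : K) m :
  (forall i, (i < m)%N -> x + i%:R != 0) -> poch x m != 0.
Proof. by move=> h; apply/prodf_neq0 => i _; apply: h. Qed.

Lemma poch_root (K : numFieldType) (x : K) m i :
  (i < m)%N -> x = - i%:R -> poch x m = 0.
Proof.
move=> im ->; apply/eqP; rewrite poch_eq0; apply/existsP.
by exists (Ordinal im); rewrite addNr.
Qed.

Lemma poch_diff (K : numFieldType) (x : K) m :
  poch (x + 1) m.+1 - poch x m.+1 = m.+1%:R * poch (x + 1) m.
Proof. rewrite pochSr pochS; ring. Qed.

Lemma pochN_bin (K : numFieldType) n m :
  poch (- n%:R : K) m = (-1) ^+ m * 'C(n, m)%:R * m`!%:R.
Proof.
have [lt_nm|le_mn] := ltnP n m.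
  by rewrite bin_small // mulr0 mul0r (poch_root _ _ _ n).
rewrite pochN -mulrA -natrM bin_ffact; congr (_ * _).
elim: m n le_mn => [|m IH] [|n] // le_mn; first by rewrite poch0.
  by rewrite poch0.
rewrite pochSr ffactSS natrM -IH // mulrC.
congr (_ * poch _ _); ring.
Qed.

(** * An Abel-type expansion of the Pochhammer symbol *)

Lemma horner_eq_shift (K : numFieldType) (p q : {poly K}) (x : K) :
  (forall j : nat, p.[x + j%:R] = q.[x + j%:R]) -> p = q.
Proof.
move=> pq; apply/eqP; rewrite -subr_eq0; apply/eqP.
pose rs := [seq x + j%:R | j <- iota 0 (size (p - q))].
apply: (@roots_geq_poly_eq0 _ _ rs); last by rewrite size_map size_iota.
  by apply/allP => _ /mapP[j _ ->]; rewrite rootE hornerE hornerN pq subrr.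
rewrite map_inj_uniq ?iota_uniq // => i j /addrI /eqP.
by rewrite eqr_nat => /eqP.
Qed.

Lemma horner_poch (K : numFieldType) (e x : K) m :
  (\prod_(i < m) ('X + (e + i%:R)%:P)).[x] = poch (x + e) m.
Proof.
by rewrite horner_prod; apply: eq_bigr => i _; rewrite hornerD hornerX hornerC addrA.
Qed.

Definition unit_steps (k : nat -> nat) :=
  forall m, (k m <= k m.+1 <= (k m).+1)%N.

(** These bounds place k_{m+1} - k_1 among 0, ..., m, hence make the
    Pochhammer symbol of length m + 1 in [poch_expansion] vanish at a = - k_1. *)
Lemma unit_steps_first (k : nat -> nat) m :
  unit_steps k -> (k 1 <= k m.+1 <= k 1 + m)%N.
Proof.
move=> hk; elim: m => [|m /andP[IH1 IH2]]; first by rewrite addn0 leqnn.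
have /andP[h1 h2] := hk m.+1; lia.
Qed.

(** Viewed as polynomials in a, the (a + k_m - m + 1)_m are lowered by the
    forward difference, up to a shift of the sequence k, exactly as (c + a)_n
    is.  So the two sides have the same difference, by induction, and it
    remains to compare them at one point; a = - k_1 kills all terms but m = 0.
    Agreement at all points - k_1 + j then forces equality of polynomials. *)
Lemma poch_expansion (K : numFieldType) (n : nat) (k : nat -> nat) (a c : K) :
  unit_steps k ->
  \sum_(m < n.+1) 'C(n, m)%:R * poch (a + (k m)%:R - m%:R + 1) m
     * poch (c + m%:R - (k m.+1)%:R) (n - m) = poch (c + a) n.
Proof.
elim: n k a c => [|n IH] k a c hk.
  by rewrite big_ord1 bin0 !poch0 !mulr1.
pose S (a : K) := \sum_(m < n.+2) 'C(n.+1, m)%:R * poch (a + (k m)%:R - m%:R + 1) m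
     * poch (c + m%:R - (k m.+1)%:R) (n.+1 - m).
rewrite -/(S a).
have Sdiff x : S (x + 1) - S x = n.+1%:R * poch (c + x + 1) n.
  (* the term m = 0 does not depend on a and drops out of the difference *)
  rewrite /S -sumrB big_ord_recl /= !poch0 subrr add0r.
  have hk' : unit_steps (fun m => k m.+1) by move=> m; apply: hk.
  have := IH _ x (c + 1) hk'.
  rewrite (_ : c + 1 + x = c + x + 1); last by ring.
  move=> <-; rewrite mulr_sumr; apply: eq_bigr => i _.
  rewrite /bump /= add1n subSS -mulrBl -mulrBr.
  set z := x + (k i.+1)%:R - i.+1%:R + 1.
  rewrite (_ : x + 1 + (k i.+1)%:R - i.+1%:R + 1 = z + 1); last by rewrite /z; ring.
  rewrite poch_diff (_ : z + 1 = x + (k i.+1)%:R - i%:R + 1); last by rewrite /z; ring.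
  rewrite (_ : c + 1 + i%:R - (k i.+2)%:R = c + i.+1%:R - (k i.+2)%:R); last by ring.
  rewrite !mulrA; do 2!congr (_ * _).
  by rewrite -!natrM mulnC -mul_bin_diag.
have S0 : S (- (k 1)%:R) = poch (c - (k 1)%:R) n.+1.
  rewrite /S big_ord_recl /= poch0 bin0 !mul1r addr0 big1 ?addr0 // => i _.
  rewrite /bump /= add1n.
  have /andP[h1 h2] := unit_steps_first _ i hk.
  (* the factor of index i - (k_(i+1) - k_1) is zero *)
  rewrite (poch_root _ _ _ (i - (k i.+1 - k 1))) ?mulr0 ?mul0r //; first by lia.
  rewrite !natrB ?leq_subLR //; ring.
have Snat (j : nat) : S (- (k 1)%:R + j%:R) = poch (c + (- (k 1)%:R + j%:R)) n.+1.
  elim: j => [|j IHj]; first by rewrite addr0 S0.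
  rewrite (_ : - (k 1)%:R + j.+1%:R = (- (k 1)%:R + j%:R) + 1); last by ring.
  set x := - (k 1)%:R + j%:R in IHj *.
  by rewrite -[LHS](subrK (S x)) Sdiff -poch_diff IHj subrK (addrA c x 1).
pose p : {poly K} := \sum_(m < n.+2)
  ('C(n.+1, m)%:R * poch (c + m%:R - (k m.+1)%:R) (n.+1 - m))
  *: \prod_(i < m) ('X + ((k m)%:R - m%:R + 1 + i%:R)%:P).
have pS x : p.[x] = S x.
  rewrite /p horner_sum; apply: eq_bigr => m _.
  rewrite hornerZ horner_poch !addrA; ring.
pose q : {poly K} := \prod_(i < n.+1) ('X + (c + i%:R)%:P).
have qS x : q.[x] = poch (c + x) n.+1 by rewrite horner_poch addrC.
rewrite -pS -qS; congr (_.[_]).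
by apply: (@horner_eq_shift _ _ _ (- (k 1)%:R)) => j; rewrite pS qS Snat.
Qed.

(** * The merged sum *)

(** The term of index m of the merged sum, up to the factor (c)_n; k and k'
    stand for [m/(l+1)] and [(m+1)/(l+1)].  The truncated n - m - 1 is
    harmless at m = n, where it is multiplied by n - m. *)
Definition summand (K : numFieldType) (n : nat) (a b c : K) (m k k' : nat) : K :=
  'C(n, m)%:R * poch (a + k%:R - m%:R + 1) m
  * (poch (c + m%:R - k'%:R) (n - m)
     + b * (n - m)%:R * poch (c + m%:R + 1 - k'%:R) (n - m).-1).

(** The coefficient of b is again an instance of [poch_expansion], since
    (n - m) binom(n, m) = n binom(n - 1, m). *)
Lemma sum_summand (K : numFieldType) (n : nat) (k : nat -> nat) (a b c : K) :
  unit_steps k -> c + a != 0 ->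
  \sum_(m < n.+1) summand K n a b c m (k m) (k m.+1)
  = (c + a + b * n%:R) / (c + a) * poch (c + a) n.
Proof.
move=> hk hca; rewrite mulrDl divff // mulrDl mul1r.
rewrite -[in X in _ = X + _](poch_expansion _ _ _ _ _ hk).
rewrite /summand; under eq_bigr do rewrite mulrDr.
rewrite big_split /=; congr (_ + _).
case: n => [|n]; first by rewrite big_ord1 /= subnn !mulr0 !mul0r mulr0.
rewrite big_ord_recr /= subnn mulr0 mul0r mulr0 addr0.
rewrite pochS mulrA divfK //.
rewrite (_ : c + a + 1 = (c + 1) + a); last by ring.
rewrite -(poch_expansion _ _ _ _ _ hk) mulr_sumr; apply: eq_bigr => m _.
have -> : (n.+1 - m).-1 = (n - m)%N by rewrite subSn //= -ltnS.
rewrite (_ : c + m%:R + 1 - (k m.+1)%:R = c + 1 + m%:R - (k m.+1)%:R); last by ring.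
rewrite !mulrA; congr (_ * _).
have := congr1 (fun s => s%:R : K) (mul_bin_down n.+1 m); rewrite !natrM /= => e.
set A := poch _ _.
have -> : b * n.+1%:R * 'C(n, m)%:R * A = b * A * (n.+1%:R * 'C(n, m)%:R) by ring.
by rewrite e; ring.
Qed.

(** The bridge to hypergeometric terms: (-n)_m / m! carries the binomial
    coefficient, (a+1)_k (-a)_{m-k} is up to sign one product of m consecutive
    factors, and the two denominators cancel against (c)_n because
    (1-c-n)_{k'} is up to sign (c+n-k')_{k'}, which ends where (c)_n ends. *)
Lemma summand_fraction (K : numFieldType) (n : nat) (a b c : K) (m k k' : nat) :
  (k <= m)%N -> (k' <= m.+1)%N ->
  poch c n != 0 -> poch c (m.+1 - k') != 0 -> poch (1 - c - n%:R) k' != 0 ->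
  (-1) ^+ (k + k') * (poch (- n%:R) m / m`!%:R)
  * (poch (a + 1) k * poch (- a) (m - k))
  * (c + b * (n%:R - m%:R) + m%:R - k'%:R)
  / (poch c (m.+1 - k') * poch (1 - c - n%:R) k')
  = summand K n a b c m k k' / poch c n.
Proof.
move=> lkm lkm' hcn; rewrite /summand pochN_bin.
have hf : m`!%:R != 0 :> K by rewrite pnatr_eq0 -lt0n fact_gt0.
rewrite mulfK //.
have [lt_nm|le_mn] := ltnP n m.
  by rewrite bin_small // !(mulr0, mul0r).
rewrite (_ : 1 - c - n%:R = - (c + n%:R - 1)); last by ring.
rewrite !pochN.
rewrite (_ : c + n%:R - 1 - k'%:R + 1 = c + n%:R - k'%:R); last by ring.
have hN (j : nat) : (-1) ^+ j != 0 :> K by rewrite expf_neq0 ?oppr_eq0 ?oner_eq0.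
rewrite !mulf_eq0 !negb_or hN /= => h1 h2.
have Ea : poch (a + k%:R - m%:R + 1) m
    = poch (a - (m - k)%:R + 1) (m - k) * poch (a + 1) k.
  rewrite -{2}(subnK lkm) pochD natrB //.
  by congr (poch _ _ * poch _ _); ring.
(* (c)_{m+1-k'} and (c+n-k')_{k'} leave a gap of n - m - 1 factors in (c)_n; at
   m = n they overlap in one factor instead, namely c + n - k'. *)
have ED : (c + b * (n%:R - m%:R) + m%:R - k'%:R) /
     (poch c (m.+1 - k') * poch (c + n%:R - k'%:R) k')
   = (poch (c + m%:R - k'%:R) (n - m)
     + b * (n - m)%:R * poch (c + m%:R + 1 - k'%:R) (n - m).-1) / poch c n.
  apply/eqP; rewrite eqr_div ?mulf_neq0 //; apply/eqP.
  move: le_mn; rewrite leq_eqVlt => /predU1P[emn|lt_mn].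
    rewrite -emn subnn poch0 !mulr0 mul0r addr0 mul1r subrr mulr0 addr0.
    case: {h1 h2 hcn Ea} k' lkm' => [|k'] hk'.
      by rewrite subn0 poch0 mulr1 pochSr subr0 mulrC.
    rewrite subSS pochS.
    rewrite mulrCA; congr (_ * _).
    rewrite -{1}(subnK (_ : k' <= m)%N) // pochD natrB //.
    by congr (poch _ _ * poch _ _); ring.
  have [d ed] : exists d, n = (m + d.+1)%N.
    by exists (n - m.+1)%N; lia.
  have -> : (n - m = d.+1)%N by lia.
  rewrite /= pochS.
  have -> : poch c n = poch c (m.+1 - k') * poch (c + m%:R + 1 - k'%:R) d
      * poch (c + n%:R - k'%:R) k'.
    rewrite (_ : poch c n = poch c (m.+1 - k' + d + k')); last first.
      by congr poch; lia.
    rewrite !pochD; congr (_ * poch _ _ * poch _ _); first by rewrite natrB //; ring.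
    by rewrite ed !natrD natrB //; ring.
  rewrite (_ : c + m%:R - k'%:R + 1 = c + m%:R + 1 - k'%:R); last by ring.
  by rewrite ed; ring.
rewrite Ea -[in RHS]mulrA -{}ED; set X := _ - k'%:R in h2 *.
have -> : poch c (m.+1 - k') * ((-1) ^+ k' * poch X k')
    = (-1) ^+ k' * (poch c (m.+1 - k') * poch X k') by ring.
rewrite invfM invr_sign.
have sgn : (-1) ^+ (k + k') * (-1) ^+ m * (-1) ^+ (m - k) * (-1) ^+ k' = 1 :> K.
  rewrite -!exprD (_ : (_ + _)%N = (2 * (m + k'))%N); last by lia.
  by rewrite exprM sqrrN !expr1n.
by rewrite -[RHS]mul1r -[X in _ = X * _]sgn; ring.
Qed.

(** * Finite series and products over parameter families *)

(** Cutting at a common length N, rather than at the parameter that stops the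
    series, lets all the series be added term by term. *)
Lemma hypF_finite (K : numFieldType) (us ls : seq K) (z : K) (N : nat) :
  (forall k, (N <= k)%N -> hyp_term us ls z k = 0) ->
  hypF us ls z = \sum_(0 <= k < N) hyp_term us ls z k.
Proof.
move=> h0; apply: cvg_lim; first exact: norm_hausdorff.
apply: cvg_near_cst; near=> M.
have le_NM : (N <= M)%N by near: M; exact: nbhs_infty_ge.
rewrite /series /= (big_cat_nat _ le_NM) //=.
rewrite [X in _ + X]big1_seq ?addr0 // => k /andP[_].
by rewrite mem_index_iota => /andP[le_Nk _]; apply: h0.
Unshelve. all: by end_near. Qed.

(** Also at p = 0, where the power is 0 ^ 0 = 1; the families indexed by
    1, ..., l are empty when l = 0. *)
Lemma natrX_mul_neq0 (K : numFieldType) p k : p%:R ^+ (k * p) != 0 :> K.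
Proof.
by case: p => [|p]; rewrite ?muln0 ?expr0 ?oner_eq0 // expf_neq0 // pnatr_eq0.
Qed.

(** Gauss's multiplication theorem: the p progressions of step p starting at
    x, ..., x + p - 1 together list the factors of (x)_{kp}. *)
Lemma poch_multiplication (K : numFieldType) (x : K) p k :
  \prod_(0 <= j < p) poch ((x + j%:R) / p%:R) k = poch x (k * p) / p%:R ^+ (k * p).
Proof.
elim: k => [|k IH].
  by rewrite poch0 divr1 big1 // => j _; rewrite poch0.
under eq_bigr do rewrite pochSr.
rewrite big_split /= IH mulSn addnC pochD exprD invfM mulrACA; congr (_ * _).
case: p {IH} => [|p]; first by rewrite big_geq // poch0 divr1.
have hp : p.+1%:R != 0 :> K by rewrite pnatr_eq0.
rewrite big_mkord /poch -[X in _ ^+ X](card_ord p.+1) -prodr_const -prodf_div.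
apply: eq_bigr => j _; rewrite natrM; field.
by rewrite addrC natr1.
Qed.

Lemma prod_params (K : numFieldType) r s (x : nat -> K) (F : K -> K) :
  \prod_(u <- params r s x) F u = \prod_(r <= j < s.+1) F (x j).
Proof. by rewrite /params big_map. Qed.

Lemma prod_params0 (K : numFieldType) (y : K) l k (x : nat -> K) :
  (forall j, x j = (y + j%:R) / (l%:R + 1)) ->
  \prod_(u <- params 0 l x) poch u k
  = poch y (k * l.+1) / l.+1%:R ^+ (k * l.+1).
Proof.
move=> hx; rewrite prod_params -poch_multiplication.
by apply: eq_bigr => j _; rewrite hx natr1.
Qed.

Lemma prod_params1 (K : numFieldType) (y : K) l k (x : nat -> K) :
  (forall j, x j.+1 = (y + j%:R) / l%:R) ->
  \prod_(u <- params 1 l x) poch u k = poch y (k * l) / l%:R ^+ (k * l).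
Proof.
move=> hx; rewrite prod_params big_add1 -poch_multiplication.
by apply: eq_bigr => j _; rewrite hx.
Qed.

Lemma big_nat1_rev (K : numFieldType) l (F : nat -> K) :
  \prod_(1 <= j < l.+1) F j = \prod_(0 <= j < l) F (l - j)%N.
Proof. by rewrite big_nat_rev big_add1. Qed.

(** Moving 0, ..., r up by l turns the window [0, l) into [r + 1, r + 1 + l).
    This is how the integer parts in the lower parameters rearrange l
    progressions into those starting at r + 1. *)
Lemma prod_wrap (K : numFieldType) l r (f : nat -> K) : (r < l)%N ->
  \prod_(0 <= j < l) f (if (j <= r)%N then j + l else j)%N
  = \prod_(0 <= s < l) f (r.+1 + s)%N.
Proof.
move=> rl; have -> : \prod_(0 <= s < l) f (r.+1 + s)%N
    = \prod_(r.+1 <= s < l + r.+1) f s.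
  rewrite -{2}[r.+1]add0n big_addn addnK.
  by apply: eq_bigr => s _; rewrite addnC.
rewrite (@big_cat_nat _ _ _ r.+1) //= (@big_cat_nat _ _ _ l r.+1 (l + r.+1)) ?leq_addr //=.
rewrite mulrC; congr (_ * _).
  apply: eq_big_nat => j /andP[h _]; rewrite leqNgt h //.
rewrite -{2}[l]add0n big_addn addKn.
by apply: eq_big_nat => j /andP[_ h]; rewrite -ltnS h.
Qed.

Lemma carry_rev l r j : (r < l)%N -> (j < l)%N ->
  ((r.+1 + (l - j)) %/ l.+1 = (j <= r))%N.
Proof.
move=> rl jl; case: leqP => h /=.
  have -> : (r.+1 + (l - j) = l.+1 + (r - j))%N by lia.
  by rewrite divnDl // divnn /= divn_small //; lia.
by rewrite divn_small //; lia.
Qed.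

(** With j replaced by l - j the parameters are (c + j)/l, increased by 1 when
    j <= r: those are the (c + s)/l for l consecutive values of s. *)
Lemma prod_lower_c (K : numFieldType) (c : K) l r k : (r < l)%N ->
  \prod_(u <- params 1 l
     (fun j => (l%:R - j%:R + c) / l%:R + ((r.+1 + j) %/ l.+1)%:R)) poch u k
  = poch (c + r.+1%:R) (k * l) / l%:R ^+ (k * l).
Proof.
move=> rl; have l0 : l%:R != 0 :> K by rewrite pnatr_eq0; lia.
rewrite prod_params big_nat1_rev -poch_multiplication.
transitivity (\prod_(0 <= s < l) poch ((c + (r.+1 + s)%:R) / l%:R) k); last first.
  by apply: eq_bigr => s _; rewrite natrD addrA.
rewrite -(prod_wrap _ _ _ (fun s => poch ((c + s%:R) / l%:R) k)) //.
apply: eq_big_nat => j /andP[_ jl]; rewrite carry_rev // natrB ?(ltnW jl) //.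
congr poch; case: leqP => _ /=; rewrite ?natrD; field; exact: l0.
Qed.

(** Only k = 1 can occur in the double product, and only for the r + 1 largest
    indices j. *)
Lemma denomE (K : numFieldType) (c : K) l r : (r < l)%N ->
  denom l c r.+1 = poch c r.+1.
Proof.
move=> rl; rewrite /denom big_nat1_rev.
transitivity (\prod_(0 <= j < l) (if (j <= r)%N then c + j%:R else 1)).
  apply: eq_big_nat => j /andP[_ jl]; rewrite carry_rev //.
  case: leqP => _ /=; last by rewrite big_geq.
  by rewrite big_nat1 natrB ?(ltnW jl) //; ring.
rewrite (@big_cat_nat _ _ _ r.+1) //= [X in _ * X]big1_seq ?mulr1; last first.
  by move=> j /andP[_]; rewrite mem_index_iota => /andP[h _]; rewrite leqNgt h.
by rewrite /poch big_mkord; apply: eq_bigr => j _; rewrite -ltnS ltn_ord.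
Qed.

Lemma denom0E (K : numFieldType) (c : K) l : denom0 l c = poch c l.
Proof.
rewrite /denom0 big_nat1_rev /poch -(big_mkord xpredT (fun j => c + j%:R)).
apply: eq_big_nat => j /andP[_ jl]; rewrite natrB ?(ltnW jl) //; ring.
Qed.

Lemma prodf_cat (K : numFieldType) (s t : seq K) (F : K -> K) :
  \prod_(u <- s ++ t) F u = (\prod_(u <- s) F u) * \prod_(u <- t) F u.
Proof. exact: big_cat. Qed.

(** * Terms of the two kinds of series *)

Lemma hyp_term_upper (K : numFieldType) l n (a b c : K) r k : (r < l)%N ->
  hyp_term (upper l n a b c r.+1) (lower l n b c r.+1) 1 k =
  poch (a + 1) k * (poch (1 + Defs.ratio l n b c r.+1) k / poch (Defs.ratio l n b c r.+1) k)
  * (poch (r%:R - n%:R) (k * l.+1) / poch r.+1%:R (k * l.+1))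
  * (poch (r%:R - a) (k * l) / (poch (1 - c - n%:R) k * poch (c + r.+1%:R) (k * l))).
Proof.
move=> rl; rewrite /hyp_term /upper /lower !prodf_cat.
rewrite (prod_params0 _ (r%:R - n%:R)); last by move=> j; congr (_ / _); ring.
rewrite (prod_params1 _ (r%:R - a)); last by move=> j; congr (_ / _); ring.
rewrite (prod_params0 _ r.+1%:R) // prod_lower_c //.
rewrite !big_cons !big_nil !mulr1 poch1 expr1n.
have h1 := natrX_mul_neq0 K l.+1 k; have h2 := natrX_mul_neq0 K l k.
have h3 : k`!%:R != 0 :> K by rewrite pnatr_eq0 -lt0n fact_gt0.
move: (l.+1%:R ^+ _) (l%:R ^+ _) (k`!%:R) h1 h2 h3 => u v w h1 h2 h3.
rewrite !invfM !invrK.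
transitivity ((w / w) * (u / u) * (v / v) * (poch (a + 1) k *
  (poch (1 + Defs.ratio l n b c r.+1) k / poch (Defs.ratio l n b c r.+1) k) *
  (poch (r%:R - n%:R) (k * l.+1) / poch r.+1%:R (k * l.+1)) *
  (poch (r%:R - a) (k * l) / poch (1 - c - n%:R) k / poch (c + r.+1%:R) (k * l)))).
  by ring.
by rewrite !divff // !mul1r !mulrA.
Qed.

Lemma hyp_term_upper0 (K : numFieldType) l n (a b c : K) k :
  hyp_term (upper0 l n a b c) (lower0 l n b c) 1 k =
  poch (a + 1) k * (poch (1 + Defs.ratio0 l n b c) k / poch (Defs.ratio0 l n b c) k)
  * (poch (l%:R - n%:R) (k * l.+1) / poch l.+1%:R (k * l.+1))
  * (poch (l%:R - a) (k * l) / (poch (2 - c - n%:R) k * poch (c + l%:R) (k * l))).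
Proof.
have h1 := natrX_mul_neq0 K l.+1 k; have h2 := natrX_mul_neq0 K l k.
have h3 : k`!%:R != 0 :> K by rewrite pnatr_eq0 -lt0n fact_gt0.
(* the full family of l + 1 parameters starts with (l+1)/(l+1) = 1, and (1)_k
   is the k! of the series *)
have Ek : k`!%:R * \prod_(v <- params 1 l (fun j => (l%:R + j%:R + 1) / (l%:R + 1))) poch v k
    = poch l.+1%:R (k * l.+1) / l.+1%:R ^+ (k * l.+1) :> K.
  rewrite -(prod_params0 _ l.+1%:R l k (fun j => (l%:R + j%:R + 1) / (l%:R + 1))).
    rewrite !prod_params [RHS]big_ltn // addr0 divff ?poch1 //.
    by rewrite natr1 pnatr_eq0.
  by move=> j; congr (_ / _); ring.
rewrite /hyp_term /upper0 /lower0 !prodf_cat.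
rewrite (prod_params0 _ (l%:R - n%:R)); last by move=> j; congr (_ / _); ring.
rewrite (prod_params1 _ (l%:R - a)); last by move=> j; congr (_ / _); ring.
have -> : \prod_(v <- params 1 l (fun j => (2 * l%:R - j%:R + c) / l%:R)) poch v k
    = poch (c + l%:R) (k * l) / l%:R ^+ (k * l).
  rewrite prod_params big_nat1_rev -poch_multiplication.
  apply: eq_big_nat => j /andP[_ jl]; rewrite natrB ?(ltnW jl) //.
  by congr (poch (_ / _) _); ring.
have -> : \prod_(v <- params 1 l (fun j => (l%:R + j%:R + 1) / (l%:R + 1))) poch v k
    = poch l.+1%:R (k * l.+1) / l.+1%:R ^+ (k * l.+1) / k`!%:R :> K.
  by rewrite -Ek mulrC mulKf.
rewrite !big_cons !big_nil !mulr1 expr1n.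
move: (l.+1%:R ^+ _) (l%:R ^+ _) (k`!%:R) h1 h2 h3 => u v w h1 h2 h3.
rewrite !invfM !invrK.
transitivity ((w / w) * (u / u) * (v / v) * (poch (a + 1) k *
  (poch (1 + Defs.ratio0 l n b c) k / poch (Defs.ratio0 l n b c) k) *
  (poch (l%:R - n%:R) (k * l.+1) / poch l.+1%:R (k * l.+1)) *
  (poch (l%:R - a) (k * l) / poch (2 - c - n%:R) k / poch (c + l%:R) (k * l)))).
  by ring.
by rewrite !divff // !mul1r !mulrA.
Qed.

Lemma fact_poch (K : numFieldType) r p :
  r`!%:R * poch r.+1%:R p = (r + p)`!%:R :> K.
Proof. by rewrite -!poch1 pochD nat1r. Qed.

(** The parameter pair (1 + x, x) inserts a factor affine in k. *)
Lemma poch_ratio (K : numFieldType) (x : K) k :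
  ~ nonpos_integer x -> x * (poch (1 + x) k / poch x k) = x + k%:R.
Proof.
move=> hx; have h : poch x k != 0.
  apply: poch_neq0 => j _; apply/eqP => /eqP.
  by rewrite addr_eq0 => /eqP e; apply: hx; exists j.
by rewrite mulrA [1 + x]addrC -pochS pochSr mulrC mulKf.
Qed.

(** * The terms of each series as terms of the merged sum *)

Lemma term_upper (K : numFieldType) l n (a b c : K) r k : (r < l)%N ->
  l%:R - b * (l%:R + 1) != 0 -> ~ nonpos_integer (Defs.ratio l n b c r.+1) ->
  poch c n != 0 -> poch c (r.+1 + k * l) != 0 -> poch (1 - c - n%:R) k != 0 ->
  poch (- n%:R) r / r`!%:R
  * ((poch (- a) r * (c + b * n%:R - (b - 1) * r%:R)) / denom l c r.+1)
  * hyp_term (upper l n a b c r.+1) (lower l n b c r.+1) 1 k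
  = summand K n a b c (r + k * l.+1) k k / poch c n.
Proof.
move=> rl hb hr hcn h1 h2.
have Em : (r + k * l.+1 - k = r + k * l)%N by lia.
have Em' : ((r + k * l.+1).+1 - k = r.+1 + k * l)%N by lia.
rewrite hyp_term_upper // denomE // -summand_fraction ?Em ?Em' //; try lia.
rewrite addnn -mul2n exprM sqrrN !expr1n mul1r.
rewrite -fact_poch !pochD ![- _ + r%:R]addrC.
set N := c + b * n%:R - (b - 1) * r%:R.
have -> : c + b * (n%:R - (r + k * l.+1)%:R) + (r + k * l.+1)%:R - k%:R
    = N + k%:R * (l%:R - b * (l%:R + 1)) by rewrite /N; ring.
have EN : Defs.ratio l n b c r.+1 = N / (l%:R - b * (l%:R + 1)).
  by rewrite /Defs.ratio /N; congr (_ / _); ring.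
have -> : N = Defs.ratio l n b c r.+1 * (l%:R - b * (l%:R + 1)) by rewrite EN divfK.
rewrite -mulrDl -(poch_ratio _ (Defs.ratio l n b c r.+1)) // !invfM; ring.
Qed.

(** Here m + 1 = (k + 1)(l + 1), so k' = k + 1: the extra factor 1 - c - n of
    (1-c-n)_{k+1} stands in front of the series, and the sign of that extra
    factor is absorbed by writing the affine factor negated. *)
Lemma term_upper0 (K : numFieldType) l n (a b c : K) k :
  l%:R - b * (l%:R + 1) != 0 -> ~ nonpos_integer (Defs.ratio0 l n b c) ->
  poch c n != 0 -> poch c (l + k * l) != 0 -> poch (1 - c - n%:R) k.+1 != 0 ->
  (poch (- n%:R) l * poch (- a) l) / (l`!%:R * (1 - c - n%:R))
  * (((b - 1) * l%:R - c - b * n%:R + 1) / denom0 l c)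
  * hyp_term (upper0 l n a b c) (lower0 l n b c) 1 k
  = summand K n a b c (l + k * l.+1) k k.+1 / poch c n.
Proof.
move=> hb hr hcn h1 h2.
have Em : (l + k * l.+1 - k = l + k * l)%N by lia.
have Em' : ((l + k * l.+1).+1 - k.+1 = l + k * l)%N by lia.
rewrite hyp_term_upper0 denom0E -summand_fraction ?Em ?Em' //; try lia.
rewrite addnS addnn -mul2n exprS exprM sqrrN !expr1n mulr1.
rewrite -fact_poch !pochD pochS ![- _ + l%:R]addrC.
rewrite (_ : 1 - c - n%:R + 1 = 2 - c - n%:R); last by ring.
set N := c + b * n%:R - (b - 1) * l%:R - 1.
have -> : c + b * (n%:R - (l + k * l.+1)%:R) + (l + k * l.+1)%:R - k.+1%:R
    = N + k%:R * (l%:R - b * (l%:R + 1)) by rewrite /N; ring.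
rewrite (_ : (b - 1) * l%:R - c - b * n%:R + 1 = - N); last by rewrite /N; ring.
have -> : N = Defs.ratio0 l n b c * (l%:R - b * (l%:R + 1)).
  by rewrite /Defs.ratio0 divfK.
rewrite -mulrDl -(poch_ratio _ (Defs.ratio0 l n b c)) // !invfM; ring.
Qed.

Lemma sum_residues (K : numFieldType) n l (F : nat -> K) :
  (forall m, (n < m)%N -> F m = 0) ->
  \sum_(m < n.+1) F m
  = \sum_(0 <= r < l.+1) \sum_(0 <= k < n.+1) F (r + k * l.+1)%N.
Proof.
move=> F0; rewrite exchange_big /= -(big_mkord xpredT F).
transitivity (\sum_(0 <= m < n.+1 * l.+1) F m).
  rewrite [RHS](@big_cat_nat _ _ _ n.+1) //= ?leq_pmulr //.
  rewrite [X in _ = _ + X]big1_seq ?addr0 // => m /andP[_].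
  by rewrite mem_index_iota => /andP[h _]; apply: F0.
rewrite big_nat_mul; apply: eq_bigr => k _.
by rewrite -{1}[(k * l.+1)%N]add0n big_addn mulSn addnK.
Qed.

(** When n < r the prefactor (-n)_r vanishes, and so do all merged terms of the
    class of r; this covers the series whose upper parameters need not contain
    a nonpositive integer.  When r <= n the series stops at k = n at the
    latest. *)
Lemma hypF_multisection (K : numFieldType) (l n : nat) (a b c : K) :
  c + a != 0 -> poch c n != 0 -> 1 - c - n%:R != 0 ->
  l%:R - b * (l%:R + 1) != 0 -> denom0 l c != 0 ->
  lower_params_ok (lower0 l n b c) ->
  (forall i : nat, (1 <= i <= l)%N -> lower_params_ok (lower l n b c i)) ->
  (c + a + b * n%:R) / (c + a) * (poch (c + a) n / poch c n) =
    (poch (- n%:R) l * poch (- a) l) / (l`!%:R * (1 - c - n%:R))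
    * (((b - 1) * l%:R - c - b * n%:R + 1) / denom0 l c)
    * hypF (upper0 l n a b c) (lower0 l n b c) 1
  + \sum_(1 <= i < l.+1)
      (poch (- n%:R) i.-1 / (i.-1)`!%:R)
      * ((poch (- a) i.-1 * (c + b * n%:R - (b - 1) * (i.-1)%:R))
         / denom l c i)
      * hypF (upper l n a b c i) (lower l n b c i) 1.
Proof.
move=> hca hcn h1cn hb hden0 hlow0 hlow.
have nz1 k : poch (1 - c - n%:R) k != 0.
  apply: poch_neq0 => -[|j] _; first by rewrite addr0.
  apply/eqP => e; apply: (hlow0 (2 - c - n%:R)); first by rewrite /lower0 inE eqxx.
  by exists j; apply/eqP; rewrite -addr_eq0 -e; apply/eqP; ring.
(* for s < l, c + s is a factor of the leading denominator; for s >= l it is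
   l (v + q) with v a lower parameter and q a natural number *)
have nzc s : (0 < l)%N -> c + s%:R != 0.
  move=> l0; have [sl|ls] := ltnP s l.
    apply: contraNneq hden0 => e.
    by rewrite denom0E (poch_root _ c l s) //; apply/eqP; rewrite -addr_eq0 e.
  have lK : l%:R != 0 :> K by rewrite pnatr_eq0 -lt0n.
  set t := ((s - l) %% l)%N; set q := ((s - l) %/ l)%N.
  have tl : (t < l)%N by rewrite ltn_mod.
  have es : s = (l + t + q * l)%N by rewrite -addnA [(t + _)%N]addnC -divn_eq subnKC.
  apply/eqP => e; apply: (hlow0 ((2 * l%:R - (l - t)%:R + c) / l%:R)).
    rewrite /lower0 !mem_cat; apply/orP; right; apply/orP; right.
    apply: (@map_f _ _ (fun j => (2 * l%:R - j%:R + c) / l%:R)).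
    by rewrite mem_index_iota; lia.
  exists q; apply: (mulIf lK); rewrite divfK //.
  by apply/eqP; rewrite -subr_eq0 -e es natrB ?(ltnW tl) //; apply/eqP; ring.
pose kk m := (m %/ l.+1)%N.
have kkE r k : (r <= l)%N -> kk (r + k * l.+1)%N = k.
  by move=> rl; rewrite /kk addnC divnMDl // divn_small // addn0.
have hkk : unit_steps kk.
  move=> m; rewrite /kk leq_div2r ?leqnSn //=.
  have -> : (m %/ l.+1).+1 = ((m + l.+1) %/ l.+1)%N by rewrite divnDr // divnn addn1.
  by rewrite leq_div2r // addnS ltnS leq_addr.
rewrite mulrA -(sum_summand _ _ _ _ _ _ hkk) // mulr_suml.
rewrite (sum_residues _ _ l
  (fun m => summand K n a b c m (kk m) (kk m.+1) / poch c n)); last first.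
  by move=> m nm; rewrite /summand bin_small // !mul0r.
rewrite big_nat_recr //= addrC big_add1 /=; congr (_ + _).
  have [nl|ln] := ltnP n l.
    rewrite (poch_root _ (- n%:R) l n) // !mul0r big1 // => k _.
    by rewrite /summand bin_small ?mul0r // ltn_addr.
  rewrite (hypF_finite _ _ _ _ n.+1) => [|k nk]; last first.
    rewrite hyp_term_upper0 (poch_root _ _ (k * l.+1) (n - l)); first by rewrite mul0r mulr0 mul0r.
      by apply: leq_trans (leq_pmulr _ _); lia.
    by rewrite natrB // opprB.
  rewrite mulr_sumr; apply: eq_bigr => k _.
  rewrite term_upper0 //; first 1 last.
  - by apply: hlow0; rewrite /lower0 !inE eqxx orbT.
  - case: (posnP l) => [->|l0]; first by rewrite muln0 poch0 oner_eq0.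
    by apply: poch_neq0 => j _; apply: nzc.
  by rewrite kkE // (_ : (l + _).+1 = (0 + k.+1 * l.+1)%N) ?kkE //; lia.
apply: eq_big_nat => r /andP[_ rl].
have [nr|rn] := ltnP n r.
  rewrite (poch_root _ (- n%:R) r n) // !mul0r big1 // => k _.
  by rewrite /summand bin_small ?mul0r // ltn_addr.
rewrite (hypF_finite _ _ _ _ n.+1) => [|k nk]; last first.
  rewrite hyp_term_upper // (poch_root _ _ (k * l.+1) (n - r)); first by rewrite mul0r mulr0 mul0r.
    by apply: leq_trans (leq_pmulr _ _); lia.
  by rewrite natrB // opprB.
rewrite mulr_sumr; apply: eq_bigr => k _.
rewrite term_upper //; first 1 last.
- by apply: (hlow r.+1) => //; rewrite /lower !inE eqxx orbT.
- by apply: poch_neq0 => j _; apply: nzc; apply: leq_ltn_trans rl.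
by rewrite kkE ?(ltnW rl) // -addSn kkE.
Qed.

Theorem theorem5p3 (R : realType) (l n : nat) (a b c : R[i])
  (hca : c + a != 0)
  (hcn : poch c n != 0)
  (h1cn : 1 - c - n%:R != 0)
  (hb : l%:R - b * (l%:R + 1) != 0)
  (hden0 : denom0 l c != 0)
  (hden : forall i : nat, (1 <= i <= l)%N -> denom l c i != 0)
  (hlow0 : lower_params_ok (lower0 l n b c))
  (hlow : forall i : nat, (1 <= i <= l)%N -> lower_params_ok (lower l n b c i)) :
  (c + a + b * n%:R) / (c + a) * (poch (c + a) n / poch c n) =
    (poch (- n%:R) l * poch (- a) l) / (l`!%:R * (1 - c - n%:R))
    * (((b - 1) * l%:R - c - b * n%:R + 1) / denom0 l c)
    * hypF (upper0 l n a b c) (lower0 l n b c) 1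
  + \sum_(1 <= i < l.+1)
      (poch (- n%:R) i.-1 / (i.-1)`!%:R)
      * ((poch (- a) i.-1 * (c + b * n%:R - (b - 1) * (i.-1)%:R))
         / denom l c i)
      * hypF (upper l n a b c i) (lower l n b c i) 1.
Proof. exact: hypF_multisection. Qed.
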